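(* Let $R$ be a join CTRS over a signature $\mathcal{F}$. Then there exists an $\mathcal{F}$-identical and non-erasing tree homomorphism $\phi$ such that $\mathbb{U}(\mathcal{D}et(R))=\phi(\mathbb{U}_{\mathrm{J}}(R))$. Consequently, if $\mathbb{U}\circ\mathcal{D}et$ is sound for $R$ then $\mathbb{U}_{\mathrm{J}}$ is sound for $R$, and if $\mathbb{U}\circ\mathcal{D}et$ is sound for $R$ w.r.t. EV-safe reduction of $\mathbb{U}(\mathcal{D}et(R))$ then $\mathbb{U}_{\mathrm{J}}$ is sound for $R$ w.r.t. EV-safe reduction of $\mathbb{U}_{\mathrm{J}}(R)$.
   Context: Terms $T(\mathcal{F},\mathcal{V})$, $\mathrm{Var}(\cdot)$ variables occurring, $\mathrm{Pos}_{\mathcal{F}}$/$\mathrm{Pos}_{\mathcal{V}}$ function-symbol/variable positions, $t|_p$ subterm, $p\le q$ prefix order. A join CTRS over $\mathcal{F}$ is a set of rules $\rho: l\to r\Leftarrow s_1\downarrow t_1;\dots;s_k\downarrow t_k$ with $l\notin\mathcal{V}$; rewrite relation $\to_R=\bigcup_n\to_{(n),R}$, $\to_{(0),R}=\emptyset$, $\to_{(i+1),R}=\{(C[l\sigma],C[r\sigma])\mid s_j\sigma,t_j\sigma\text{ have a common }\to^*_{(i),R}\text{-reduct}\ \forall j\}$. $\overrightarrow{X}$ is a fixed listing of a finite set $X$. $\mathbb{U}_{\mathrm{J}}(\rho)=\{l\to U^\rho(s_1,t_1,\dots,s_k,t_k,\overrightarrow{\mathrm{Var}(l)}),\ U^\rho(x_1,x_1,\dots,x_k,x_k,\overrightarrow{\mathrm{Var}(l)})\to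 r\}$ for $k\ge1$ (fresh $U^\rho$, fresh distinct $x_i$), unconditional rules kept. $\mathcal{D}et$: for each rule with $k$ conditions a fresh $2k$-ary constructor $\mathsf{eq}_k$ and fresh distinct variables $x_1,\dots,x_k$: $\mathcal{D}et(\rho)=l\to r\Leftarrow\mathsf{eq}_k(s_1,t_1,\dots,s_k,t_k)\twoheadrightarrow\mathsf{eq}_k(x_1,x_1,\dots,x_k,x_k)$ (an oriented condition); $\mathcal{D}et(R)=\{\mathcal{D}et(\rho)\mid\rho\in R\}$. Ohlebusch's $\mathbb{U}$ on an oriented rule $l\to r\Leftarrow s_1\twoheadrightarrow t_1;\dots;s_m\twoheadrightarrow t_m$ ($m\ge1$): with $X_i=\mathrm{Var}(l,t_1,\dots,t_{i-1})$ and fresh $U^\rho_1,\dots,U^\rho_m$, $\{l\to U^\rho_1(s_1,\overrightarrow{X_1})\}\cup\{U^\rho_i(t_i,\overrightarrow{X_i})\to U^\rho_{i+1}(s_{i+1},\overrightarrow{X_{i+1}})\mid 1\le i<m\}\cup\{U^\rho_m(t_m,\overrightarrow{X_m})\to r\}$; unconditional rules kept. All extended to rule sets by union. A transformation $U$ is sound for $R$ over $\mathcal{F}$ if $s\to^*_{U(R)}t$ implies $s\to^*_Rt$ for all $s,t\in T(\mathcal{F},\mathcal{V})$, and sound w.r.t. EV-safe reduction if $s\to^*_{\mathrm{evs},U(R)}t$ implies $s\to^*_Rt$ for such $s,t$, where for an unconditional system $S$ and $t_0\to_{p_1,l_1\to r_1}t_1\to\cdots$: $B_0=\mathrm{Pos}_{\mathcal{F}}(t_0)$,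 $B_i=(B_{i-1}\setminus\{q\in B_{i-1}\mid q\ge p_i\})\cup\{p_iq\mid q\in\mathrm{Pos}_{\mathcal{F}}(r_i)\}\cup\{p_ip'q\mid p_ipq\in B_{i-1},p\in\mathrm{Pos}_{\mathcal{V}}(l_i),l_i|_p=r_i|_{p'}\}$, EV-safe if $p_i\in B_{i-1}$ for all $i$, and $\to^*_{\mathrm{evs},S}$ means a finite EV-safe sequence exists. A tree homomorphism $\phi$ is given by terms $\phi(f)$ over $\{x_1,\dots,x_n\}$ for each $n$-ary $f$, with $\phi(x)=x$, $\phi(f(t_1,\dots,t_n))=\phi(f)\{x_i\mapsto\phi(t_i)\}$, applied to rules componentwise; $\mathcal{F}$-identical: $\phi(f)=f(x_1,\dots,x_n)$ for $f\in\mathcal{F}$; non-erasing: $\mathrm{Var}(\phi(f))=\{x_1,\dots,x_n\}$ for all $f$.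
   Formalization: Det is taken to keep unconditional rules unchanged (as both unravelings do); applying its formula with k=0 would add the condition eq_0 ↠ eq_0, and the equality would fail, e.g. for R={a→b}. For rules with k≥1 conditions, Det is as stated. *)

(* Defs.v *)
From mathcomp Require Import all_boot.
From mathcomp Require Import finmap.
From mathcomp Require Import boolp classical_sets.
From Stdlib Require Import Relation_Operators.

Set Implicit Arguments.
Unset Strict Implicit.
Unset Printing Implicit Defensive.

Local Open Scope classical_set_scope.
Local Open Scope fset_scope.

Record signature := Signature { symbol :> Type; arity : symbol -> nat }.

Inductive term (F : signature) (V : Type) : Type :=
| Var of V
| App (f : F) of ('I_(arity f) -> term F V).

Arguments Var {F V} _.
Arguments App {F V} f _.

Definition appt {F : signature} {V : Type} (f : F)
    (ts : (arity f).-tuple (term F V)) : term F V := App f (tnth ts).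

Fixpoint subst {F : signature} {V W : Type} (sigma : V -> term F W)
    (t : term F V) : term F W :=
  match t with
  | Var x => sigma x
  | App f a => App f (fun i => subst sigma (a i))
  end.

Fixpoint vars {F : signature} {V : choiceType} (t : term F V) : {fset V} :=
  match t with
  | Var x => [fset x]
  | App f a => \bigcup_(i <- enum 'I_(arity f)) vars (a i)
  end.

(* Argument positions are numbered from 0. *)
Notation position := (seq nat).

Fixpoint subterm {F : signature} {V : Type} (t : term F V) (p : position) :
    option (term F V) :=
  match p, t with
  | [::], _ => Some t
  | i :: q, App f a =>
      if (insub i : option 'I_(arity f)) is Some j then subterm (a j) q else None
  | _ :: _, Var _ => None
  end.

(* [replace t p u] is t[u]_p; it is only used when p is a position of t. *)
Fixpoint replace {F : signature} {V : Type} (t : term F V) (p : position)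
    (u : term F V) : term F V :=
  match p, t with
  | [::], _ => u
  | i :: q, App f a =>
      App f (fun j => if j == i :> nat then replace (a j) q u else a j)
  | _ :: _, Var _ => t
  end.

Definition PosF {F : signature} {V : Type} (t : term F V) : set position :=
  [set p | exists f a, subterm t p = Some (App f a)].

Definition PosV {F : signature} {V : Type} (t : term F V) : set position :=
  [set p | exists x, subterm t p = Some (Var x)].

Definition rule (F : signature) (V : Type) : Type := (term F V * term F V)%type.

(* s = C[l sigma] and t = C[r sigma], where C is s with a hole at p. *)
Definition contract {F : signature} {V : Type} (l r : term F V)
    (sigma : V -> term F V) (p : position) (s t : term F V) : Prop :=
  subterm s p = Some (subst sigma l) /\ t = replace s p (subst sigma r).

Definition step_at {F : signature} {V : Type} (rl : rule F V) (p : position)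
    (s t : term F V) : Prop :=
  exists sigma, contract rl.1 rl.2 sigma p s t.

Definition step {F : signature} {V : Type} (S : set (rule F V))
    (s t : term F V) : Prop :=
  exists rl p, S rl /\ step_at rl p s t.

Definition steps {F : signature} {V : Type} (S : set (rule F V)) :
    term F V -> term F V -> Prop :=
  clos_refl_trans _ (step S).

(* The passage from B_{i-1} to B_i for a step at p with rule rl. *)
Definition evs_next {F : signature} {V : Type} (B : set position)
    (p : position) (rl : rule F V) : set position :=
  ([set q | B q /\ ~~ prefix p q]
   `|` [set p ++ q | q in PosF rl.2]
   `|` [set q' | exists pl pr q,
          [/\ B (p ++ pl ++ q), PosV rl.1 pl,
              subterm rl.1 pl = subterm rl.2 pr & q' = p ++ pr ++ q]])%classic.

Inductive evs_from {F : signature} {V : Type} (S : set (rule F V)) :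
    set position -> term F V -> term F V -> Prop :=
| evs_refl B t : evs_from S B t t
| evs_step B p rl s t u :
    S rl -> step_at rl p s t -> B p -> evs_from S (evs_next B p rl) t u ->
    evs_from S B s u.

Definition evs_steps {F : signature} {V : Type} (S : set (rule F V))
    (s t : term F V) : Prop :=
  evs_from S (PosF s) s t.

(* The pairs in [conds] are read as s |v t in a join system, and as s ->> t in
   an oriented one. *)
Record crule (F : signature) (V : Type) := CRule {
  lhs : term F V;
  rhs : term F V;
  conds : seq (term F V * term F V) }.

Definition crule_vars {F : signature} {V : choiceType} (rho : crule F V) :
    {fset V} :=
  vars (lhs rho) `|` vars (rhs rho)
  `|` \bigcup_(c <- conds rho) (vars c.1 `|` vars c.2).

Definition join_CTRS {F : signature} {V : Type} (R : set (crule F V)) : Prop :=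
  forall rho, R rho -> ~ exists x, lhs rho = Var x.

Definition joinable {T : Type} (r : T -> T -> Prop) (s t : T) : Prop :=
  exists u, clos_refl_trans _ r s u /\ clos_refl_trans _ r t u.

Fixpoint jstep_n {F : signature} {V : Type} (R : set (crule F V)) (n : nat)
    (s t : term F V) : Prop :=
  if n is m.+1 then
    exists rho sigma p,
      [/\ R rho,
          forall j : 'I_(size (conds rho)),
            let c := tnth (in_tuple (conds rho)) j in
            joinable (jstep_n R m) (subst sigma c.1) (subst sigma c.2)
        & contract (lhs rho) (rhs rho) sigma p s t]
  else False.

Definition jstep {F : signature} {V : Type} (R : set (crule F V))
    (s t : term F V) : Prop :=
  exists n, jstep_n R n s t.

Definition jsteps {F : signature} {V : Type} (R : set (crule F V)) :
    term F V -> term F V -> Prop :=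
  clos_refl_trans _ (jstep R).

Definition ext (F : signature) (T : Type) (a : T -> nat) : signature :=
  @Signature (F + T)%type
    (fun f => match f with inl g => arity g | inr u => a u end).

Fixpoint emb {F : signature} {T : Type} {a : T -> nat} {V : Type}
    (t : term F V) : term (ext F a) V :=
  match t with
  | Var x => Var x
  | App f args => @App (ext F a) V (inl f) (fun i => emb (args i))
  end.

Lemma unpair_subproof {T : Type} {k : nat} (ps : k.-tuple (T * T)) :
  size (flatten [seq [:: c.1; c.2] | c <- ps]) == k.*2.
Proof.
case: ps => ps /= /eqP <-.
by elim: ps => //= c ps /eqP ->.
Qed.

Definition unpair {T : Type} {k : nat} (ps : k.-tuple (T * T)) :
  (k.*2).-tuple T := Tuple (unpair_subproof ps).

(* A fixed listing of every finite set: a tuple of length #|X| with the same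
   elements as X, hence without repetition. *)
Definition listing {V : choiceType}
    (vec : forall X : {fset V}, #|` X|.-tuple V) : Prop :=
  forall X, vec X =i X.

(* The choice of fresh variables is shared by U_J and Det; [fresh rho] is the
   sequence of variables x_1, ..., x_k for rho. *)
Definition fresh_choice {F : signature} {V : choiceType} (R : set (crule F V))
    (fresh : forall rho : crule F V, (size (conds rho)).-tuple V) : Prop :=
  forall rho, R rho ->
    uniq (fresh rho) /\ (forall x, x \in fresh rho -> x \notin crule_vars rho).

Definition cond_rules {F : signature} {V : Type} (R : set (crule F V)) :
    set (crule F V) :=
  [set rho | R rho /\ 0 < size (conds rho)].

Definition dup_vars {F : signature} {V : Type} {k : nat} (xs : k.-tuple V) :
    k.-tuple (term F V * term F V) :=
  [tuple of [seq (Var x, Var x) | x <- xs]].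

Definition emb_pairs {F : signature} {T : Type} {a : T -> nat} {V : Type}
    {k : nat} (ps : k.-tuple (term F V * term F V)) :
    k.-tuple (term (ext F a) V * term (ext F a) V) :=
  [tuple of [seq (emb c.1, emb c.2) | c <- ps]].

Section UJ.
Context {F : signature} {V : choiceType}.
Context (vec : forall X : {fset V}, #|` X|.-tuple V).
Context (fresh : forall rho : crule F V, (size (conds rho)).-tuple V).
Context (R : set (crule F V)).

Definition UJ_arity (u : set_type (cond_rules R)) : nat :=
  (size (conds (val u))).*2 + #|` vars (lhs (val u))|.

Definition UJ_sig : signature := ext F UJ_arity.

Definition UJ_app (u : set_type (cond_rules R))
    (ps : (size (conds (val u))).-tuple (term UJ_sig V * term UJ_sig V)) :
    term UJ_sig V :=
  @appt UJ_sig V (inr u)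
    [tuple of unpair ps ++ [seq Var x | x <- vec (vars (lhs (val u)))]].

Inductive UJ : set (rule UJ_sig V) :=
| UJ_uncond rho : R rho -> conds rho = [::] -> UJ (emb (lhs rho), emb (rhs rho))
| UJ_first (u : set_type (cond_rules R)) :
    UJ (emb (lhs (val u)), UJ_app (emb_pairs (in_tuple (conds (val u)))))
| UJ_last (u : set_type (cond_rules R)) :
    UJ (UJ_app (dup_vars (fresh (val u))), emb (rhs (val u))).

End UJ.

Arguments UJ {F V} vec fresh R _.

Section Det.
Context {F : signature} {V : choiceType}.
Context (fresh : forall rho : crule F V, (size (conds rho)).-tuple V).
Context (R : set (crule F V)).

(* The numbers k of the constructors eq_k: one symbol per number of conditions,
   shared by all the rules with that number. *)
Definition cond_sizes : set nat :=
  [set size (conds rho) | rho in cond_rules R].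

Definition Det_sig : signature :=
  ext F (fun k : set_type cond_sizes => (val k).*2).

Lemma cond_size_subproof (u : set_type (cond_rules R)) :
  size (conds (val u)) \in cond_sizes.
Proof. by apply: mem_set; exists (val u) => //; apply: set_mem (valP u). Qed.

Definition eq_app (u : set_type (cond_rules R))
    (ps : (size (conds (val u))).-tuple (term Det_sig V * term Det_sig V)) :
    term Det_sig V :=
  @appt Det_sig V
    (inr (exist (fun k => k \in cond_sizes) _ (cond_size_subproof u)))
    (unpair ps).

(* Unconditional rules are kept: no eq_0 is introduced for them. *)
Inductive Det : set (crule Det_sig V) :=
| Det_uncond rho : R rho -> conds rho = [::] ->
    Det (CRule (emb (lhs rho)) (emb (rhs rho)) [::])
| Det_cond (u : set_type (cond_rules R)) :
    Det (CRule (emb (lhs (val u))) (emb (rhs (val u)))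
      [:: (eq_app (emb_pairs (in_tuple (conds (val u)))),
           eq_app (dup_vars (fresh (val u))))]).

End Det.

Arguments Det {F V} fresh R _.

Section U.
Context {F : signature} {V : choiceType}.
Context (vec : forall X : {fset V}, #|` X|.-tuple V).
Context (R : set (crule F V)).

(* Conditions are numbered from 0: this is X_{i+1}. *)
Definition U_vars (rho : crule F V) (i : nat) : {fset V} :=
  vars (lhs rho) `|` \bigcup_(c <- take i (conds rho)) vars c.2.

(* One symbol for each rule and each of its conditions (none for an
   unconditional rule). *)
Definition U_symbol : Type :=
  {u : set_type R & 'I_(size (conds (val u)))}.

Definition U_sig : signature :=
  ext F (fun w : U_symbol => (#|` U_vars (val (tag w)) (tagged w)|).+1).

Definition U_app (w : U_symbol) (t : term F V) : term U_sig V :=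
  @appt U_sig V (inr w)
    [tuple of emb t :: [seq Var x | x <- vec (U_vars (val (tag w)) (tagged w))]].

Definition U_cond (w : U_symbol) : term F V * term F V :=
  tnth (in_tuple (conds (val (tag w)))) (tagged w).

Inductive U : set (rule U_sig V) :=
| U_uncond rho : R rho -> conds rho = [::] -> U (emb (lhs rho), emb (rhs rho))
| U_first (w : U_symbol) :
    tagged w = 0 :> nat ->
    U (emb (lhs (val (tag w))), U_app w (U_cond w).1)
| U_next (u : set_type R) (i j : 'I_(size (conds (val u)))) :
    j = i.+1 :> nat ->
    U (U_app (existT _ u i) (U_cond (existT _ u i)).2,
       U_app (existT _ u j) (U_cond (existT _ u j)).1)
| U_last (w : U_symbol) :
    (tagged w).+1 = size (conds (val (tag w))) ->
    U (U_app w (U_cond w).2, emb (rhs (val (tag w)))).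

End U.

Arguments U {F V} vec R _.

(* [inj] is the inclusion of the terms over F in those over F'. *)
Definition sound {F F' : signature} {V : Type}
    (inj : term F V -> term F' V) (S : set (rule F' V)) (R : set (crule F V)) :
    Prop :=
  forall s t : term F V, steps S (inj s) (inj t) -> jsteps R s t.

Definition sound_evs {F F' : signature} {V : Type}
    (inj : term F V -> term F' V) (S : set (rule F' V)) (R : set (crule F V)) :
    Prop :=
  forall s t : term F V, evs_steps S (inj s) (inj t) -> jsteps R s t.

(* The variables x_1, ..., x_n of phi(f) are the elements of 'I_n. *)
Definition tree_hom (F G : signature) : Type :=
  forall f : F, term G 'I_(arity f).

Fixpoint hom_term {F G : signature} (phi : tree_hom F G) {V : Type}
    (t : term F V) : term G V :=
  match t with
  | Var x => Var x
  | App f a => subst (fun i => hom_term phi (a i)) (phi f)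
  end.

Definition hom_rule {F G : signature} (phi : tree_hom F G) {V : Type}
    (rl : rule F V) : rule G V :=
  (hom_term phi rl.1, hom_term phi rl.2).

Definition non_erasing {F G : signature} (phi : tree_hom F G) : Prop :=
  forall (f : F) (i : 'I_(arity f)), i \in vars (phi f).

(* phi(f) = f(x_1, ..., x_n) for f in F; the domain extends F, and the codomain
   contains F through inj. *)
Definition identical {F G : signature} {T : Type} {a : T -> nat}
    (inj : forall W : Type, term F W -> term G W)
    (phi : tree_hom (ext F a) G) : Prop :=
  forall f : F, phi (inl f) = inj _ (App f Var).

(* Main.v *)
(** The homomorphism [phi] replaces U^rho(y_1, ..., y_2k, zs) by
    U^rho(eq_k(y_1, ..., y_2k), zs): it groups the arguments coming from the
    conditions of [rho], and it is linear and non-collapsing besides being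
    non-erasing.  Hence every position p of a term s has exactly one image in
    phi(s), and a step of s at p is mapped to a single step of phi(s) at that
    image.  The image of positions commutes with substitution and replacement and
    reflects the prefix order, so it also maps each B_i into its counterpart:
    EV-safe reductions are mapped to EV-safe reductions.  As [phi] is the
    identity on terms over F, soundness is transferred. *)

Require Import Defs.
From mathcomp Require Import all_boot finmap boolp classical_sets.
From Stdlib Require Import Relation_Operators.

Set Implicit Arguments.
Unset Strict Implicit.
Unset Printing Implicit Defensive.

(** * Positions, replacement and substitution in terms *)

Section Terms.
Context {F : signature}.

Lemma eq_App {V : Type} (f : F) (a b : 'I_(arity f) -> term F V) :
  a =1 b -> App f a = App f b.
Proof. by move=> ab; congr (App f _); apply: funext. Qed.

Lemma subst_subst {V W X : Type} (sigma : V -> term F W) (tau : W -> term F X)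
    (t : term F V) :
  subst tau (subst sigma t) = subst (fun x => subst tau (sigma x)) t.
Proof. by elim: t => //= f a IH; apply: eq_App. Qed.

Lemma subterm_nil {V : Type} (t : term F V) : subterm t [::] = Some t.
Proof. by case: t. Qed.

Lemma subterm_App {V : Type} (f : F) (a : 'I_(arity f) -> term F V) i p :
  subterm (App f a) (nat_of_ord i :: p) = subterm (a i) p.
Proof. by rewrite /= valK. Qed.

Lemma subterm_cat {V : Type} (t : term F V) p q :
  subterm t (p ++ q) = obind (fun u => subterm u q) (subterm t p).
Proof.
by elim: p t => [|i p IH] [x|f a] //=; case: (insub i) => //= j; apply: IH.
Qed.

Lemma subterm_subst {V W : Type} (sigma : V -> term F W) (t u : term F V) p :
  subterm t p = Some u -> subterm (subst sigma t) p = Some (subst sigma u).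
Proof.
elim: p t => [|i p IH] t; first by rewrite !subterm_nil => -[<-].
by case: t => //= f a; case: (insub i) => //= j; apply: IH.
Qed.

Lemma subterm_replace {V : Type} (t v u : term F V) p :
  subterm t p = Some v -> subterm (replace t p u) p = Some u.
Proof.
elim: p t => [|i p IH] [x|f a] //=; rewrite ?subterm_nil //.
by case: insubP => //= j _ <-; rewrite eqxx; apply: IH.
Qed.

(** A position that is not at or below p survives, though its subterm changes when q lies above p;
    hence the existential [w']. *)
Lemma subterm_replace_nprefix {V : Type} (t v w u : term F V) p q :
  subterm t p = Some v -> subterm t q = Some w -> ~~ prefix p q ->
  exists w', subterm (replace t p u) q = Some w'.
Proof.
elim: p t q => [|i p IH] [x|f a] [|j q] //=; rewrite ?prefix0s //; first by eexists.
case: insubP => //= i' _ <-; case: insubP => //= j' _ <-.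
case: (eqVneq i' j') => [<-|ij] tp tq; first by rewrite eqxx /=; apply: IH tp tq.
by move=> _; rewrite eq_sym val_eqE (negPf ij); exists w.
Qed.

Lemma subterm_Var_vars {V : choiceType} (t : term F V) p x :
  subterm t p = Some (Var x) -> (x \in vars t)%fset.
Proof.
elim: p t => [|i p IH] [y|f a] //=; first by case=> ->; rewrite inE.
case: (insub i) => //= j /IH xa; apply/bigfcupP; exists j => //.
by rewrite mem_enum.
Qed.

Lemma vars_emb {T : Type} {a : T -> nat} {V : choiceType} (t : term F V) :
  vars (emb t : term (ext F a) V) = vars t.
Proof. by elim: t => //= f b IH; apply: eq_bigr => i _; apply: IH. Qed.

(** Since x occurs in t at p alone, changing [sigma] at x affects the instance only inside that one
    copy of [sigma x]. *)
Lemma subst_replace {V : eqType} {W : Type} (sigma : V -> term F W)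
    (t : term F V) p x q u :
  subterm t p = Some (Var x) ->
  (forall p', subterm t p' = Some (Var x) -> p' = p) ->
  subst (fun y => if y == x then replace (sigma y) q u else sigma y) t =
  replace (subst sigma t) (p ++ q) u.
Proof.
elim: t p => [y|f a IH] [|i p] //=; first by case=> ->; rewrite eqxx.
case: insubP => //= j lti ji tp uniq; apply: eq_App => k.
rewrite -ji val_eqE; case: eqVneq => [->|kj].
  apply: IH => // p' tp'.
  by have /= := uniq (nat_of_ord j :: p'); rewrite valK => /(_ tp') [].
(* Arguments off the path to p do not contain x, so the modified substitution agrees with [sigma] on
   them. *)
have no p' : subterm (a k) p' <> Some (Var x).
  move=> tp'; have /= := uniq (nat_of_ord k :: p').
  by rewrite valK => /(_ tp') [] kk _; rewrite -ji in kk;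
    rewrite (val_inj kk) eqxx in kj.
elim: (a k) no {IH tp} => [y|g b IH] no /=.
  by case: eqVneq => // yx; case: (no [::]); rewrite yx.
apply: eq_App => m; apply: IH => p' bp'.
by apply: (no (nat_of_ord m :: p')) => /=; rewrite valK.
Qed.

End Terms.

(** * Linear, non-erasing and non-collapsing tree homomorphisms, and their action on positions *)

Section LinearHom.
Context {F G : signature}.
Variables (phi : tree_hom F G) (occ : forall f : F, 'I_(arity f) -> position).
(** Existence of an occurrence of each variable is non-erasure; its uniqueness, [occ_uniq], is
    linearity. *)
Hypothesis occP : forall f i, subterm (phi f) (occ i) = Some (Var i).
Hypothesis occ_uniq : forall f i p, subterm (phi f) p = Some (Var i) -> p = occ i.
Hypothesis non_collapsing : forall f, exists g b, phi f = App g b.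

Lemma linear_non_erasing : non_erasing phi.
Proof. by move=> f i; apply: subterm_Var_vars (occP i). Qed.

Lemma hom_subst {V W : Type} (sigma : V -> term F W) (t : term F V) :
  hom_term phi (subst sigma t) =
  subst (fun x => hom_term phi (sigma x)) (hom_term phi t).
Proof.
elim: t => //= f a IH; rewrite subst_subst.
by congr (subst _ _); apply: funext => i; apply: IH.
Qed.

(* Junk value [::] when p is not a position of t. *)
Fixpoint hom_pos {V : Type} (t : term F V) (p : position) : position :=
  match p, t with
  | i :: q, App f a =>
      if (insub i : option 'I_(arity f)) is Some j then occ j ++ hom_pos (a j) q
      else [::]
  | _, _ => [::]
  end.

Lemma subterm_hom {V : Type} (t u : term F V) p :
  subterm t p = Some u ->
  subterm (hom_term phi t) (hom_pos t p) = Some (hom_term phi u).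
Proof.
elim: p t => [|i p IH] t.
  by case: t => [x|f a]; rewrite !subterm_nil => -[<-].
case: t => //= f a; case: (insub i) => //= j /IH aj.
by rewrite subterm_cat (subterm_subst _ (occP j)).
Qed.

Lemma hom_pos_cat {V : Type} (t u : term F V) p q :
  subterm t p = Some u -> hom_pos t (p ++ q) = hom_pos t p ++ hom_pos u q.
Proof.
elim: p t => [|i p IH] [x|f a] //=; try by case=> <-.
by case: (insub i) => //= j /IH ->; rewrite catA.
Qed.

Lemma hom_pos_subst {V W : Type} (sigma : V -> term F W) (t u : term F V) p :
  subterm t p = Some u -> hom_pos (subst sigma t) p = hom_pos t p.
Proof.
elim: p t => [|i p IH] [x|f a] //=; first by case: (sigma x).
by case: (insub i) => //= j /IH ->.
Qed.

(** Linearity is essential: with a second occurrence of the variable, an unreplaced copy of the old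
    subterm would remain. *)
Lemma hom_replace {V : Type} (t v u : term F V) p :
  subterm t p = Some v ->
  hom_term phi (replace t p u) =
  replace (hom_term phi t) (hom_pos t p) (hom_term phi u).
Proof.
elim: p t => [|i p IH] [x|f a] //=; first by case: (subst _ _).
case: insubP => //= j _ <- /IH aj.
rewrite -(subst_replace _ _ _ (occP j) (@occ_uniq _ _)).
congr (subst _ _); apply: funext => k; rewrite val_eqE.
by case: eqVneq => // ->.
Qed.

Lemma hom_pos_replace {V : Type} (t v u : term F V) p :
  subterm t p = Some v -> hom_pos (replace t p u) p = hom_pos t p.
Proof.
elim: p t => [|i p IH] t; first by case: t; case: u.
by case: t => //= f a; case: insubP => //= j _ <- /IH; rewrite eqxx => ->.
Qed.

(** [hom_pos] depends only on the symbols passed on the way to q, and the replacement leaves these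
    unchanged. *)
Lemma hom_pos_replace_nprefix {V : Type} (t v u : term F V) p q :
  subterm t p = Some v -> ~~ prefix p q ->
  hom_pos (replace t p u) q = hom_pos t q.
Proof.
elim: p t q => [|i p IH] [x|f a] [|j q] //=; rewrite ?prefix0s //.
case: insubP => //= i' _ <-; case: insubP => //= j' _ <-.
move=> tp; case: (eqVneq i' j') => [<-|ij]; last first.
  by rewrite [in if _ then _ else _]eq_sym val_eqE (negPf ij).
by rewrite eqxx /= => pq; rewrite IH.
Qed.

(** A variable is a leaf, so no position properly extends [occ i]. *)
Lemma occ_cat_inj (f : F) (i j : 'I_(arity f)) r :
  occ j = occ i ++ r -> i = j.
Proof.
move=> e; have := occP j; rewrite e subterm_cat occP /=.
by case: r {e} => //= -[].
Qed.

Lemma occ_neq0 (f : F) (i : 'I_(arity f)) : occ i != [::].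
Proof.
apply/eqP => e; have := occP i; rewrite e /=.
by have [g [b ->]] := non_collapsing f.
Qed.

(** Of the two occurrences the shorter is a prefix of the longer, which [occ_cat_inj] allows only
    for equal indices. *)
Lemma prefix_occ (f : F) (i j : 'I_(arity f)) p q :
  prefix (occ i ++ p) (occ j ++ q) -> i = j.
Proof.
move=> /prefixP[r]; rewrite -catA => e.
case: (leqP (size (occ i)) (size (occ j))) => [le|/ltnW le].
  apply: (@occ_cat_inj _ _ _ (drop (size (occ i)) (occ j))).
  have := congr1 (take (size (occ i))) e.
  rewrite (takel_cat _ le) take_size_cat // => ti.
  by rewrite -[LHS](cat_take_drop (size (occ i))) ti.
apply/esym/(@occ_cat_inj _ _ _ (drop (size (occ j)) (occ i))).
have := congr1 (take (size (occ j))) e.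
rewrite (takel_cat _ le) take_size_cat // => tj.
by rewrite -[LHS](cat_take_drop (size (occ j))) -tj.
Qed.

Lemma hom_pos_nprefix {V : Type} (t v w : term F V) p q :
  subterm t p = Some v -> subterm t q = Some w -> ~~ prefix p q ->
  ~~ prefix (hom_pos t p) (hom_pos t q).
Proof.
elim: p t q => [|i p IH] [x|f a] [|j q] //=; rewrite ?prefix0s //.
  (* Here q is the root and p lies below it; the image of p stays below the root because [phi] is
     non-collapsing. *)
  case: (insub i) => //= k _ _ _.
  by case: (occ k) (occ_neq0 k).
case: insubP => //= i' _ <-; case: insubP => //= j' _ <-.
move=> tp tq; case: (eqVneq i' j') => [eij|ij].
  by rewrite -{j'}eij eqxx /= in tq *; rewrite prefix_catr // eqxx; apply: IH.
by move=> _; apply/negP => /prefix_occ /eqP; rewrite (negPf ij).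
Qed.

Lemma hom_pos_PosF {V : Type} (t : term F V) p :
  PosF t p -> PosF (hom_term phi t) (hom_pos t p).
Proof.
move=> [f [a /subterm_hom tp]].
have [g [b fE]] := non_collapsing f.
by exists g, (fun i => subst (fun j => hom_term phi (a j)) (b i)); rewrite tp /= fE.
Qed.

(** * Simulation of plain and EV-safe reductions *)

Lemma hom_step_at {V : Type} (rl : rule F V) p (s t : term F V) :
  step_at rl p s t ->
  step_at (hom_rule phi rl) (hom_pos s p) (hom_term phi s) (hom_term phi t).
Proof.
move=> [sigma [sp ->]]; exists (fun x => hom_term phi (sigma x)).
by split; rewrite /= -hom_subst ?(subterm_hom sp) ?(hom_replace _ sp).
Qed.

Lemma hom_steps {V : Type} (S : set (rule F V)) (S' : set (rule G V))
    (s t : term F V) :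
  (forall rl, S rl -> S' (hom_rule phi rl)) ->
  steps S s t -> steps S' (hom_term phi s) (hom_term phi t).
Proof.
move=> SS'; elim=> {s t} [s t [rl [p [Srl st]]]|s|s t u _ st _ tu].
- apply: rt_step; exists (hom_rule phi rl), (hom_pos s p).
  by split; [apply: SS'|apply: hom_step_at].
- exact: rt_refl.
- exact: rt_trans st tu.
Qed.

(** Invariant of the simulation: B consists of positions of the current term, and their images lie
    in B'. The three parts of [evs_next] are matched one by one. *)
Lemma hom_evs_next {V : Type} (B : set position) (B' : set position)
    (rl : rule F V) p (s t : term F V) :
  step_at rl p s t ->
  (forall q, B q -> (exists v, subterm s q = Some v) /\ B' (hom_pos s q)) ->
  forall q, evs_next B p rl q ->
    (exists v, subterm t q = Some v) /\
    evs_next B' (hom_pos s p) (hom_rule phi rl) (hom_pos t q).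
Proof.
move=> [sigma [sp ->]] BB' q.
have tp := subterm_replace (subst sigma rl.2) sp.
have tpE := hom_pos_replace (subst sigma rl.2) sp.
move=> [[[Bq npq]|[q' rq' <-]]|[pl [pr [q' [Bp [x lx] lr ->]]]]].
- have [[v sq] B'q] := BB' _ Bq; split.
    exact: subterm_replace_nprefix sp sq npq.
  rewrite (hom_pos_replace_nprefix _ sp npq); left; left; split=> //.
  exact: hom_pos_nprefix sp sq npq.
- have [f [a rq]] := rq'; split.
    by rewrite subterm_cat tp /= (subterm_subst _ rq); eexists.
  rewrite (hom_pos_cat _ tp) tpE (hom_pos_subst _ rq); left; right.
  by exists (hom_pos rl.2 q') => //; apply: hom_pos_PosF.
(* The redex and the contractum share the instance [sigma x], so q' has the same image inside it on
   both sides. *)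
- have [[v]] := BB' _ Bp; rewrite lx in lr; have rx := esym lr.
  rewrite subterm_cat sp /= subterm_cat (subterm_subst _ lx) /= => xq.
  rewrite (hom_pos_cat _ sp) (hom_pos_cat _ (subterm_subst sigma lx)).
  rewrite (hom_pos_subst _ lx) => B'q; split.
    by rewrite subterm_cat tp /= subterm_cat (subterm_subst _ rx) /= xq; eexists.
  rewrite (hom_pos_cat _ tp) tpE (hom_pos_cat _ (subterm_subst sigma rx)).
  rewrite (hom_pos_subst _ rx); right.
  exists (hom_pos rl.1 pl), (hom_pos rl.2 pr), (hom_pos (sigma x) q'); split=> //.
    by exists x; rewrite (subterm_hom lx).
  by rewrite (subterm_hom lx) (subterm_hom rx).
Qed.

Lemma hom_evs_steps {V : Type} (S : set (rule F V)) (S' : set (rule G V))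
    (s t : term F V) :
  (forall rl, S rl -> S' (hom_rule phi rl)) ->
  evs_steps S s t -> evs_steps S' (hom_term phi s) (hom_term phi t).
Proof.
move=> SS' st; rewrite /evs_steps.
have : forall q, PosF s q ->
    (exists v, subterm s q = Some v) /\ PosF (hom_term phi s) (hom_pos s q).
  by move=> q sq; split; [case: sq => f [a ->]; eexists|apply: hom_pos_PosF].
(* The induction needs arbitrary B and B' related by the invariant, since later sets are no longer
   the function positions of the initial terms. *)
move: (PosF (hom_term phi s)) => B'; move: st; rewrite /evs_steps.
move: (PosF s) => B st.
elim: st B' => {B s t} [B t B' _|B p rl s t u Srl st Bp _ IH B' BB'].
  exact: evs_refl.
apply: (@evs_step _ _ _ _ (hom_pos s p) (hom_rule phi rl) _ (hom_term phi t)).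
- exact: SS'.
- exact: hom_step_at.
- by have [] := BB' _ Bp.
- by apply: IH; apply: hom_evs_next.
Qed.

End LinearHom.

Lemma hom_emb {F : signature} {T T' T'' : Type} {a : T -> nat} {a' : T' -> nat}
    {b : T'' -> nat} (phi : tree_hom (ext F b) (ext (ext F a) a')) {V : Type}
    (t : term F V) :
  identical (fun W (t : term F W) => emb (emb t)) phi ->
  hom_term phi (emb t) = emb (emb t).
Proof.
move=> id_phi; elim: t => //= f c IH; rewrite id_phi /=.
exact: (@eq_App (ext (ext F a) a') V (inl (inl f))).
Qed.

(** The length of a listing is part of its type, so listings of provably equal sets are compared
    through a cast of the index. *)
Lemma tnth_vec {V : choiceType} (vec : forall X : {fset V}, #|` X|%fset.-tuple V)
    (X Y : {fset V}) (eXY : #|` X|%fset = #|` Y|%fset) i :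
  X = Y -> tnth (vec X) i = tnth (vec Y) (cast_ord eXY i).
Proof. by move=> XY; case: Y / XY eXY => e; rewrite cast_ord_id. Qed.

Lemma map_unpair {T T' : Type} {k : nat} (g : T -> T') (ps : k.-tuple (T * T)) :
  map g (unpair ps) = flatten [seq [:: g c.1; g c.2] | c <- ps].
Proof. by rewrite /= map_flatten -map_comp. Qed.

(** * The grouping homomorphism and the equality of the two unravelings *)

Section Grouping.
Context {F : signature} {V : choiceType}.
Context (vec : forall X : {fset V}, #|` X|%fset.-tuple V).
Context (fresh : forall rho : crule F V, (size (conds rho)).-tuple V).
Context (R : set (crule F V)).
Local Notation D := (Det fresh R).

Definition det_rule (u : set_type (cond_rules R)) : crule (Det_sig R) V :=
  CRule (emb (lhs (val u))) (emb (rhs (val u)))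
    [:: (eq_app (emb_pairs (in_tuple (conds (val u)))),
         eq_app (dup_vars (fresh (val u))))].

(** The index is [ord0] because a conditional rule of [Det] has exactly one condition. *)
Definition det_symbol (u : set_type (cond_rules R)) : U_symbol D :=
  existT _ (exist (fun rho => rho \in D) (det_rule u) (mem_set (Det_cond fresh u)))
    ord0.

Definition eq_symbol (u : set_type (cond_rules R)) : Det_sig R :=
  inr (exist (fun k => k \in cond_sizes R) _ (cond_size_subproof u)).

Lemma U_vars_det_symbol (u : set_type (cond_rules R)) :
  U_vars (det_rule u) 0 = vars (lhs (val u)).
Proof. by rewrite /U_vars /= big_nil fsetU0 vars_emb. Qed.

Lemma card_U_vars (u : set_type (cond_rules R)) :
  #|` U_vars (det_rule u) 0|%fset = #|` vars (lhs (val u))|%fset.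
Proof. by rewrite U_vars_det_symbol. Qed.

(** Reading the target arity as 1 + n lets [split] separate the slot of the eq_k term from the slots
    of the listed variables. *)
Definition group_hom : tree_hom (UJ_sig R) (U_sig D) := fun f =>
  match f return term (U_sig D) 'I_(@arity (UJ_sig R) f) with
  | inl g => @App (U_sig D) _ (inl (inl g)) Var
  | inr u => @App (U_sig D) _ (inr (det_symbol u)) (fun i : 'I_(1 + _) =>
      match split i with
      | inl _ => @App (U_sig D) _ (inl (eq_symbol u)) (fun j => Var (lshift _ j))
      | inr j => Var (rshift (size (conds (val u))).*2 (cast_ord (card_U_vars u) j))
      end)
  end.

(** Condition arguments sit one level deeper, inside argument 0; the listed variables are shifted by
    one past it. *)
Definition group_occ (f : UJ_sig R) : 'I_(arity f) -> position :=
  match f return 'I_(@arity (UJ_sig R) f) -> position with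
  | inl g => fun i => [:: val i]
  | inr u => fun i => match split i with
                      | inl j => [:: 0; val j]
                      | inr j => [:: j.+1]
                      end
  end.

Lemma group_hom_identical : identical (fun W (t : term F W) => emb (emb t)) group_hom.
Proof. by []. Qed.

Lemma group_hom_non_collapsing f : exists g b, group_hom f = App g b.
Proof.
by case: f => [g|u]; [exists (inl (inl g))|exists (inr (det_symbol u))]; eexists.
Qed.

(** The hypothesis compares flattened argument lists, so that the same lemma serves the actual
    conditions and the fresh pairs. *)
Lemma hom_UJ_app (u : set_type (cond_rules R))
    (ps : (size (conds (val u))).-tuple (term (UJ_sig R) V * term (UJ_sig R) V))
    (qs : (size (conds (val u))).-tuple (term (Det_sig R) V * term (Det_sig R) V)) :
  map (hom_term group_hom) (unpair ps) = map emb (unpair qs) ->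
  hom_term group_hom (UJ_app vec ps) = U_app vec (det_symbol u) (eq_app qs).
Proof.
move=> pq; rewrite /UJ_app /U_app /appt /=.
apply: (@eq_App (U_sig D) V (inr (det_symbol u))) => i.
case: (@split_ordP 1 _ i) => j ->{i}.
  rewrite (ord1 j) /=.
  have -> : lshift _ ord0 = ord0 :> 'I_(1 + #|` U_vars (det_rule u) 0|%fset).
    exact: val_inj.
  rewrite tnth0; apply: (@eq_App (U_sig D) V (inl (eq_symbol u))) => k.
  rewrite tnth_lshift.
  have := congr1 (fun s => nth (hom_term group_hom (tnth (unpair ps) k)) s k) pq.
  rewrite (nth_map (tnth (unpair ps) k)) ?(nth_map (tnth (unpair qs) k)) ?size_tuple //.
  by rewrite -!tnth_nth.
rewrite /=.
have -> : rshift 1 j = lift ord0 j by apply: val_inj.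
rewrite tnthS tnth_rshift !tnth_map /=; congr Var.
by apply/esym/tnth_vec/U_vars_det_symbol.
Qed.

Lemma group_occP f (i : 'I_(arity f)) :
  subterm (group_hom f) (group_occ i) = Some (Var i).
Proof.
case: f i => [g|u] i; first by rewrite /= valK.
have [j ->|j ->] := @split_ordP (size (conds (val u))).*2 _ i.
  rewrite /group_occ (unsplitK (inl j)).
  have := @subterm_App (U_sig D) _ (inr (det_symbol u)) _ (@lshift 1 _ ord0).
  move=> ->; rewrite (unsplitK (inl ord0)).
  exact: (@subterm_App (U_sig D) _ (inl (eq_symbol u)) _ j).
rewrite /group_occ (unsplitK (inr j)).
pose j' := cast_ord (esym (card_U_vars u)) j.
have := @subterm_App (U_sig D) _ (inr (det_symbol u)) _ (@rshift 1 _ j').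
move=> ->; rewrite (unsplitK (inr j')); congr (Some (Var (rshift _ _))).
exact: cast_ordKV.
Qed.

Lemma group_occ_uniq f (i : 'I_(arity f)) p :
  subterm (group_hom f) p = Some (Var i) -> p = group_occ i.
Proof.
case: f i => [g|u] i.
  by case: p => [|k [|m p]] //=; case: insubP => //= j _ <- // [] <-.
case: p => [|k p] //=; case: insubP => //= j _ <-.
case: (@split_ordP 1 _ j) => {}j ->.
  rewrite (ord1 j) /=.
  case: p => [|m [|? ?]] //=; case: insubP => //= l _ <- // [] <-.
  by rewrite (unsplitK (inl l)).
rewrite /=; case: p => [|? ?] //= [] <-.
by rewrite (unsplitK (inr _)).
Qed.

Lemma U_Det : U vec D = image (UJ vec fresh R) (hom_rule group_hom).
Proof.
have hom_emb_id t : hom_term group_hom (emb t) = emb (emb t) :> term (U_sig D) V.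
  exact: hom_emb group_hom_identical.
have hom_first u : hom_term group_hom (UJ_app vec (emb_pairs (in_tuple (conds (val u)))))
    = U_app vec (det_symbol u) (U_cond (det_symbol u)).1.
  apply: hom_UJ_app; rewrite !map_unpair -!map_comp; congr flatten.
  by apply: eq_map => c /=; rewrite !hom_emb_id.
have hom_last u : hom_term group_hom (UJ_app vec (dup_vars (fresh (val u))))
    = U_app vec (det_symbol u) (U_cond (det_symbol u)).2.
  by apply: hom_UJ_app; rewrite !map_unpair -!map_comp.
(* An unconditional rule contributes no symbol, its index type being empty; a conditional one
   contributes only index 0. *)
have det_symbolP (w : U_symbol D) : exists u, w = det_symbol u.
  case: w => -[rho rhoD] i; have := set_mem rhoD => rD.
  case: rho / rD rhoD i => [rho _ _|u] rhoD i; first by case: i.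
  exists u; rewrite /det_symbol (bool_irrelevance rhoD (mem_set (Det_cond fresh u))).
  by rewrite (ord1 i).
apply/seteqP; split=> [rl|_ [rl UJrl <-]].
- case=> {rl} [rho rhoD|w _|u i j ij|w _].
  + case: rho / rhoD => [rho Rrho rho0 _|u] //=.
    exists (emb (lhs rho), emb (rhs rho)); first exact: UJ_uncond.
    by rewrite /hom_rule /= !hom_emb_id.
  + have [u ->] := det_symbolP w.
    exists (emb (lhs (val u)), UJ_app vec (emb_pairs (in_tuple (conds (val u))))).
      exact: UJ_first.
    exact: (congr2 pair (hom_emb_id _) (hom_first u)).
  (* Intermediate rules cannot arise: they need two consecutive conditions, and the rule has just
     one. *)
  + have [v uiv] := det_symbolP (existT _ u i).
    have u1 : size (conds (val u)) = 1.
      exact: (congr1 (fun w : U_symbol D => size (conds (val (tag w)))) uiv).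
    have := ltn_ord j; suff -> : (j < size (conds (val u))) = false by [].
    by rewrite ij [X in _ < X]u1.
  + have [u ->] := det_symbolP w.
    exists (UJ_app vec (dup_vars (fresh (val u))), emb (rhs (val u))).
      exact: UJ_last.
    exact: (congr2 pair (hom_last u) (hom_emb_id _)).
- case: UJrl => [rho Rrho rho0|u|u]; rewrite /hom_rule [_.1]/= [_.2]/= !hom_emb_id.
  + by apply: (@U_uncond _ _ vec D (CRule (emb (lhs rho)) (emb (rhs rho)) [::])) => //;
      apply: Det_uncond.
  + by rewrite hom_first; apply: (@U_first _ _ vec D (det_symbol u)).
  + by rewrite hom_last; apply: (@U_last _ _ vec D (det_symbol u)).
Qed.

End Grouping.

Theorem theorem5p19 (F : signature) (V : choiceType)
    (vec : forall X : {fset V}, #|` X|%fset.-tuple V)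
    (fresh : forall rho : crule F V, (size (conds rho)).-tuple V)
    (R : set (crule F V))
    (hvec : listing vec)
    (hR : join_CTRS R)
    (hfresh : fresh_choice R fresh) :
  (exists phi : tree_hom (UJ_sig R) (U_sig (Det fresh R)),
     [/\ identical (fun W (t : term F W) => emb (emb t)) phi,
         non_erasing phi
       & U vec (Det fresh R) = image (UJ vec fresh R) (hom_rule phi)]) /\
  (sound (fun t => emb (emb t)) (U vec (Det fresh R)) R ->
     sound (fun t => emb t) (UJ vec fresh R) R) /\
  (sound_evs (fun t => emb (emb t)) (U vec (Det fresh R)) R ->
     sound_evs (fun t => emb t) (UJ vec fresh R) R).
Proof.
have occP := @group_occP F V fresh R.
have homE (t : term F V) := hom_emb t (@group_hom_identical F V fresh R).
have UJU rl : UJ vec fresh R rl ->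
    U vec (Det fresh R) (hom_rule (group_hom fresh (R:=R)) rl).
  by rewrite U_Det => UJrl; exists rl.
(* By [homE] the doubly embedded s and t are the images of their single embeddings, so the given
   reduction only has to be mapped. *)
split; [|split=> snd s t st; apply: snd; rewrite -!homE].
- exists (group_hom fresh (R:=R)); split; first exact: group_hom_identical.
  + exact: linear_non_erasing occP.
  + exact: U_Det.
- exact: (hom_steps occP (@group_occ_uniq _ _ _ _) UJU st).
- exact: (hom_evs_steps occP (@group_occ_uniq _ _ _ _)
            (@group_hom_non_collapsing _ _ _ _) UJU st).
Qed.
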